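(* Let $n\geq 3$ and let $\pi:\mathrm{SO}(n)\to\mathbb{R}^2$ be linear (i.e. the restriction to $\mathrm{SO}(n)$ of a linear map $\mathbb{R}^{n\times n}\to\mathbb{R}^2$). Then $\pi(\mathrm{SO}(n))$ is convex.
   Context: $\mathrm{SO}(n)=\{X\in\mathbb{R}^{n\times n}: X^\intercal X=I,\ \det(X)=1\}$. *)

(* Defs.v *)
From mathcomp Require Import all_boot all_order all_algebra.
From mathcomp Require Import classical_sets reals convex.

Set Implicit Arguments.
Unset Strict Implicit.
Unset Printing Implicit Defensive.

Import GRing.Theory.
Local Open Scope ring_scope.
Local Open Scope classical_set_scope.

Definition SO (R : realType) (n : nat) : set 'M[R]_n :=
  [set X | X^T *m X = 1%:M /\ \det X = 1].

(* Main.v *)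
(** To join [X] and [Y] in SO(n) it suffices, after translating by [X^T], to find
    for each [t] in [0, 1] a rotation with the same image as [(1 - t) I + t Y].
    In an orthonormal basis adapted to [Y] this matrix is block diagonal, its
    blocks being either 1 or [a I + b J], with [J] the quarter turn and (a, b) in
    the closed unit disc.

    When one block only is not a rotation, it extends by a third direction to
    diag(a I + b J, 1) in dimension 3, where the half-turns
    [2 q q^T / |q|^2 - I] give a family of rotations that is quadratic in [q].
    Matching the image amounts to finding a common zero of two ternary quadratic
    forms. One of them vanishes at two points of the projective plane at which the
    other takes opposite signs; these points are joined along the conic of its
    zeros, and the intermediate value theorem applies.

    When two blocks [a I + b J], [c I + d J] are not rotations, the linear map from
    (a, b, c, d) in [R^4] to [R^2] has a nontrivial kernel, and moving along it
    until one of the two discs is left makes one of the blocks a rotation without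
    changing the image. By induction on n this is needed only for n = 4. *)
Require Import Defs.
From mathcomp Require Import all_boot all_order all_algebra.
From mathcomp Require Import classical_sets interval_inference reals convex.
From mathcomp Require Import complex ring lra.

Set Implicit Arguments.
Unset Strict Implicit.
Unset Printing Implicit Defensive.

Import Order.TTheory GRing.Theory Num.Theory.
Local Open Scope ring_scope.

(** * Real eigenvectors of symmetric matrices *)

(** Over [R[i]] an eigenvalue [l] exists, and it is real because [S] is Hermitian there. It is then
    a root of the real characteristic polynomial, which yields a real eigenvector. *)
Lemma symmetric_eigenvector (R : rcfType) (n : nat) (S : 'M[R]_n.+1) :
  S^T = S -> exists (a : R) (v : 'cV[R]_n.+1), v != 0 /\ S *m v = a *: v.
Proof.
move=> symS; pose S' := map_mx (real_complex R) S.
have [l eigl] := eigenvalue_closed S' (ltn0Sn n).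
have [v vS v0] := eigenvalueP eigl.
have nv0 : (v *m (map_mx Num.conj v)^T) 0 0 != 0.
  rewrite mxE; apply: contra v0 => /eqP/psumr_eq0P h; apply/eqP/rowP => i.
  have /h/(_ i isT)/eqP : forall j, true -> 0 <= v 0 j * (map_mx Num.conj v)^T j 0.
    by move=> j _; rewrite !mxE mul_conjC_ge0.
  by rewrite !mxE mul_conjC_eq0 => /eqP.
have S'real : map_mx Num.conj S' = S'.
  apply/matrixP => i j; rewrite !mxE.
  by apply/CrealP; rewrite complex_real.
have S'T : S'^T = S' by rewrite /S' map_trmx symS.
have lreal : l^* = l.
  have e1 : v *m S' *m (map_mx Num.conj v)^T = l *: (v *m (map_mx Num.conj v)^T).
    by rewrite vS -scalemxAl.
  have e2 : v *m S' *m (map_mx Num.conj v)^T = l^* *: (v *m (map_mx Num.conj v)^T).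
    have -> : v *m S' *m (map_mx Num.conj v)^T = v *m (map_mx Num.conj (v *m S'))^T.
      by rewrite map_mxM S'real trmx_mul S'T mulmxA.
    rewrite vS; apply/matrixP => i j; rewrite !mxE big_distrr; apply: eq_bigr => k _ /=.
    by rewrite !mxE rmorphM mulrCA.
  have := congr1 (fun A : 'M_1 => A 0 0) (etrans (esym e1) e2).
  by rewrite /= mxE [RHS]mxE => /(mulIf nv0) /esym.
have [a la] : exists a : R, l = a%:C%C.
  move: lreal; case: l {eigl vS} => a b /eqP; rewrite eq_complex /= => /andP[_ /eqP bb].
  by exists a; apply/eqP; rewrite eq_complex /= eqxx /=; apply/eqP; lra.
have : eigenvalue S a.
  rewrite eigenvalue_root_char -(fmorph_root (real_complex R)) /= map_char_poly.
  by rewrite -eigenvalue_root_char -la.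
case/eigenvalueP => w wS w0; exists a, w^T; split.
  by rewrite -trmx0 (inj_eq trmx_inj).
by rewrite -{1}symS -trmx_mul wS linearZ.
Qed.

(** * Common zeros of two ternary quadratic forms *)

(** The second form has no square of x or y, so it vanishes at (1, 0, 0) and (0, 1, 0), where the
    first takes the values [f11] and [f22]. A path between these points inside the zero set of the
    second form, avoiding the origin, meets a zero of the first. *)
Lemma ternary_forms_common_zero (R : rcfType)
    (f11 f22 f33 f12 f13 f23 g33 g12 g13 g23 : R) :
  0 <= f11 -> f22 <= 0 ->
  exists x y z : R, [/\ [|| x != 0, y != 0 | z != 0],
    f11 * x ^+ 2 + f22 * y ^+ 2 + f33 * z ^+ 2
      + f12 * (x * y) + f13 * (x * z) + f23 * (y * z) = 0 &
    g33 * z ^+ 2 + g12 * (x * y) + g13 * (x * z) + g23 * (y * z) = 0].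
Proof.
move=> f11_ge0 f22_le0.
have ivt (a b c d e : R) : 0 <= a -> a + b + c + d + e <= 0 ->
    exists2 t, 0 <= t <= 1 & a + b * t + c * t ^+ 2 + d * t ^+ 3 + e * t ^+ 4 = 0.
  move=> a0 s0.
  have [|t t01 /eqP] := @poly_ivt R
    (- (a%:P + b *: 'X + c *: 'X^2 + d *: 'X^3 + e *: 'X^4)) 0 1 ler01.
    by rewrite !hornerE /=; apply/andP; split; lra.
  by rewrite !hornerE /= => /eqP h; exists t => //; lra.
pose f (x y z : R) := f11 * x ^+ 2 + f22 * y ^+ 2 + f33 * z ^+ 2
      + f12 * (x * y) + f13 * (x * z) + f23 * (y * z).
have seg (x0 y0 z0 x1 y1 z1 : R) : 0 <= f x0 y0 z0 -> f x1 y1 z1 <= 0 ->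
    exists2 t, 0 <= t <= 1 & f ((1 - t) * x0 + t * x1) ((1 - t) * y0 + t * y1)
      ((1 - t) * z0 + t * z1) = 0.
  move=> h0 h1.
  (* [b] is the polar form of [f] at the two endpoints: it is the coefficient of t (1 - t) on the
     segment. *)
  pose b := f12 * (x0 * y1 + x1 * y0) + f13 * (x0 * z1 + x1 * z0)
     + f23 * (y0 * z1 + y1 * z0)
     + 2 * (f11 * (x0 * x1) + f22 * (y0 * y1) + f33 * (z0 * z1)).
  have [||t t01 h] := ivt (f x0 y0 z0) (b - 2 * f x0 y0 z0)
     (f x0 y0 z0 + f x1 y1 z1 - b) 0 0 => //; first by lra.
  by exists t => //; rewrite -h /b /f; ring.
(* If [g12 = 0], the line z = 0 lies in the zero set and carries both points. *)
have [g120|g12_neq0] := eqVneq g12 0.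
  have [||t t01 ft] := seg 1 0 0 0 1 0; rewrite /f; [lra..|].
  exists (1 - t), t, 0; split; last by rewrite g120; ring.
    by have [->|] := eqVneq t 0; rewrite ?subr0 ?oner_neq0 ?orbT.
  by rewrite -[RHS]ft /f; ring.
pose l := - g23 / g12; pose m := - g13 / g12.
pose k := - (g33 - g13 * g23 / g12) / g12.
(* In the coordinates X = x - l z, Y = y - m z the form g is g12 (X Y - k z^2). *)
have gE (X Y z : R) : g33 * z ^+ 2 + g12 * ((X + l * z) * (Y + m * z))
    + g13 * ((X + l * z) * z) + g23 * ((Y + m * z) * z)
    = g12 * (X * Y - k * z ^+ 2).
  by rewrite /l /m /k; field.
have nz (X Y z : R) : [|| X != 0, Y != 0 | z != 0] ->
    [|| X + l * z != 0, Y + m * z != 0 | z != 0].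
  by have [->|] := eqVneq z 0; rewrite ?mulr0 ?addr0 // !orbT.
suff [X [Y [z [XYz_neq0 fXYz gXYz]]]] : exists X Y z, [/\ [|| X != 0, Y != 0 | z != 0],
    f (X + l * z) (Y + m * z) z = 0 & X * Y = k * z ^+ 2].
  exists (X + l * z), (Y + m * z), z; split; [exact: nz|exact: fXYz|].
  by rewrite gE gXYz subrr mulr0.
(* If [k = 0], the conic splits into the lines X = 0 and Y = 0, which meet at (x, y, z) = (l, m, 1).
   The sign of [f] there tells on which line it changes sign. *)
have [k0|k_neq0] := eqVneq k 0.
  have [fz_ge0|/ltW fz_le0] := lerP 0 (f l m 1).
    have [||t t01 ft] := seg l m 1 0 1 0 => //; first by rewrite /f; lra.
    exists 0, t, (1 - t); split; last by rewrite k0; ring.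
      by have [->|] := eqVneq t 0; rewrite ?subr0 ?oner_neq0 ?orbT.
    by rewrite -[RHS]ft; congr f; ring.
  have [||t t01 ft] := seg 1 0 0 l m 1 => //; first by rewrite /f; lra.
  exists (1 - t), 0, t; split; last by rewrite k0; ring.
    by have [->|] := eqVneq t 0; rewrite ?subr0 ?oner_neq0 ?orbT.
  by rewrite -[RHS]ft; congr f; ring.
(* The conic X Y = k z^2 is parametrized by (s^2, k t^2, s t), here with s = 1 - t. *)
pose F t := f ((1 - t) ^+ 2 + l * ((1 - t) * t)) (k * t ^+ 2 + m * ((1 - t) * t)) ((1 - t) * t).
(* The coefficients of s^3 t, s^2 t^2, s t^3 and t^4 in [F]; that of s^4 is [f11]. *)
pose c1 := f11 * l * 2 + f12 * m + f13.
pose c2 := f11 * l ^+ 2 + f22 * m ^+ 2 + f33 + f12 * (k + l * m) + f13 * l + f23 * m.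
pose c3 := f22 * 2 * k * m + f12 * k * l + f23 * k.
pose c4 := f22 * k ^+ 2.
have FE t : F t = f11 + (c1 - 4 * f11) * t + (c2 - 3 * c1 + 6 * f11) * t ^+ 2
   + (c3 - 2 * c2 + 3 * c1 - 4 * f11) * t ^+ 3 + (c4 - c3 + c2 - c1 + f11) * t ^+ 4.
  by rewrite /F /f /c1 /c2 /c3 /c4; ring.
have [||t t01] := ivt f11 (c1 - 4 * f11) (c2 - 3 * c1 + 6 * f11)
   (c3 - 2 * c2 + 3 * c1 - 4 * f11) (c4 - c3 + c2 - c1 + f11) => //.
  have c4_le0 : c4 <= 0 by rewrite /c4 mulr_le0_ge0 // sqr_ge0.
  by lra.
rewrite -FE => Ft; exists ((1 - t) ^+ 2), (k * t ^+ 2), ((1 - t) * t); split=> //; last by ring.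
(* At t = 0 the first coordinate is 1; elsewhere the second is nonzero because [k] is. *)
have [->|t_neq0] := eqVneq t 0; first by rewrite subr0 expr1n oner_neq0.
by apply/or3P/Or32; rewrite mulf_neq0 ?expf_neq0.
Qed.

(** * Matrices whose planar linear images are all images of rotations *)

(** The rotation may depend on [phi]. Quantifying over all [phi] makes the notion stable under
    affine substitution, since [phi] composed with a linear map is again allowed. *)
Definition attained (R : realType) (n : nat) (Z : 'M[R]_n) :=
  forall phi : {linear 'M[R]_n -> 'rV[R]_2},
    exists2 X, @SO R n X & phi X = phi Z.

Lemma SO_attained (R : realType) (n : nat) (X : 'M[R]_n) :
  @SO R n X -> attained X.
Proof. by move=> SX phi; exists X. Qed.

Lemma attained_affine (R : realType) (n p : nat) (C : 'M[R]_n)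
    (U : 'M[R]_(n, p)) (V : 'M[R]_(p, n)) (Z : 'M[R]_p) :
  attained Z -> (forall X, @SO R p X -> attained (C + U *m X *m V)) ->
  attained (C + U *m Z *m V).
Proof.
move=> attZ attX phi.
have [X SX /= eqX] := attZ (phi \o mulmxr V \o mulmx U).
have [X' SX' eqX'] := attX X SX phi.
by exists X' => //; rewrite eqX' !linearD /= eqX.
Qed.

(** Only the product of the determinants is prescribed, so that conjugation by an orthogonal matrix
    of determinant -1 is covered. *)
Lemma attained_mul (R : realType) (n : nat) (U V Z : 'M[R]_n) :
  U^T *m U = 1%:M -> V^T *m V = 1%:M -> \det U * \det V = 1 ->
  attained Z -> attained (U *m Z *m V).
Proof.
move=> oU oV dUV attZ; rewrite -[U *m Z *m V]add0r; apply: attained_affine => // X [oX dX].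
apply: SO_attained; rewrite add0r; split; last first.
  by rewrite !det_mulmx dX mulr1.
by rewrite !trmx_mul !mulmxA -[V^T *m _ *m _ *m _]mulmxA oU mulmx1 -[V^T *m _ *m _]mulmxA oX mulmx1.
Qed.

(** Blocks are treated one at a time: [Z] is first traded for a rotation, while [B] may still be
    arbitrary. *)
Lemma attained_block (R : realType) (k m : nat) (B : 'M[R]_k) (Z : 'M[R]_m) :
  attained Z -> (forall X, @SO R m X -> attained (block_mx B 0 0 X)) ->
  attained (block_mx B 0 0 Z).
Proof.
have blockE (X : 'M_m) : block_mx B 0 0 X =
    block_mx B 0 0 0 + col_mx 0 1%:M *m X *m row_mx 0 1%:M.
  by rewrite mul_col_mx mul_col_row !mul0mx !mulmx0 mul1mx mulmx1 add_block_mx !addr0 !add0r.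
by move=> attZ attX; rewrite blockE; apply: attained_affine => // X SX;
  rewrite -blockE; apply: attX.
Qed.

Lemma attained_cast (R : realType) (n n' : nat) (e : n = n') (Z : 'M[R]_n) :
  attained Z -> attained (castmx (e, e) Z).
Proof. by case: n' / e; rewrite castmx_id. Qed.

Lemma SO_block (R : realType) (k m : nat) (A : 'M[R]_k) (B : 'M[R]_m) :
  @SO R k A -> @SO R m B -> @SO R (k + m) (block_mx A 0 0 B).
Proof.
move=> [oA dA] [oB dB]; split; last by rewrite det_ublock dA dB mulr1.
by rewrite tr_block_mx mulmx_block !trmx0 !mul0mx !mulmx0 !addr0 !add0r oA oB -scalar_mx_block.
Qed.

(** * One disc block in dimension 3 *)

Definition mx3 (R : pzRingType) (a b c d e f g h k : R) : 'M[R]_3 :=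
  \matrix_(i, j) nth 0 (nth [::] [:: [:: a; b; c]; [:: d; e; f]; [:: g; h; k]] i) j.

Lemma det_mx2 (R : comPzRingType) (A : 'M[R]_2) :
  \det A = A 0 0 * A 1 1 - A 0 1 * A 1 0.
Proof.
rewrite (expand_det_row _ 0) !big_ord_recl big_ord0 /cofactor !det_mx11 !mxE /=.
rewrite expr0 expr1 addr0 mul1r mulN1r mulrN.
by congr (A _ _ * A _ _ - A _ _ * A _ _); apply: val_inj.
Qed.

Lemma det_mx3 (R : comPzRingType) (a b c d e f g h k : R) :
  \det (mx3 a b c d e f g h k) =
  a * (e * k - f * h) - b * (d * k - f * g) + c * (d * h - e * g).
Proof.
rewrite (expand_det_row _ 0) !big_ord_recl big_ord0 /cofactor !det_mx2 !mxE /=.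
by rewrite /bump /=; ring.
Qed.

(** Multiplication by a + ib on the complex plane. *)
Definition sim2 (R : pzRingType) (a b : R) : 'M[R]_(1 + 1) :=
  block_mx a%:M (- b)%:M b%:M a%:M.

Lemma sim2_mx3 (R : pzRingType) (r : R) :
  block_mx (sim2 r 0) 0 0 1%:M = mx3 r 0 0 0 r 0 0 0 1 :> 'M_(1 + 1 + 1).
Proof.
apply/matrixP => -[[|[|[|//]]] ?] -[[|[|[|//]]] ?]; rewrite !mxE.
all: do ?(case: splitP => //= -[[|[|//]] ?] //= _; rewrite ?mxE //=).
by rewrite oppr0 mul0rn.
Qed.

(* The matrix is the half-turn about (x, y, z) times diag(1, -1, -1): at z = 0 it is
   the rotation about the third axis by twice the angle of (x, y). *)
Lemma half_turn_SO (R : realType) (x y z N : R) :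
  N = x ^+ 2 + y ^+ 2 + z ^+ 2 -> N != 0 ->
  @SO R 3 (mx3 ((x ^+ 2 - y ^+ 2 - z ^+ 2) / N) (- (2 * x * y) / N) (- (2 * x * z) / N)
               (2 * x * y / N) (- (y ^+ 2 - x ^+ 2 - z ^+ 2) / N) (- (2 * y * z) / N)
               (2 * x * z / N) (- (2 * y * z) / N) (- (z ^+ 2 - x ^+ 2 - y ^+ 2) / N)).
Proof.
move=> NE; rewrite {}NE => N0; split; last by rewrite det_mx3; field; exact: N0.
apply/matrixP => -[[|[|[|//]]] ?] -[[|[|[|//]]] ?].
all: rewrite !mxE !big_ord_recl big_ord0 !mxE /=; field; exact: N0.
Qed.

Lemma disc_attained3 (R : realType) (r : R) :
  -1 <= r <= 1 -> attained (mx3 r 0 0 0 r 0 0 0 1).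
Proof.
move=> /andP[r_ge r_le] phi.
(* In the difference between half-turn family and target, scaled by N, the coefficients of x^2 and
   y^2 are [1 - r] and [- (1 + r)] times the same matrix [Q11]. *)
pose Q11 : 'M[R]_3 := mx3 1 0 0 0 1 0 0 0 0.
pose Q33 : 'M[R]_3 := mx3 (-1 - r) 0 0 0 (1 - r) 0 0 0 (- 2).
pose Q12 : 'M[R]_3 := mx3 0 (- 2) 0 2 0 0 0 0 0.
pose Q13 : 'M[R]_3 := mx3 0 0 (- 2) 0 0 0 2 0 0.
pose Q23 : 'M[R]_3 := mx3 0 0 0 0 0 (- 2) 0 (- 2) 0.
pose e := phi Q11.
have [e0|e_neq0] := eqVneq e 0.
  exists 1%:M; first by split; rewrite ?trmx1 ?mul1mx ?det1.
  rewrite -[LHS]addr0 -(scaler0 _ (r - 1)) -e0 -linearZ -linearD; congr (phi _).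
  by apply/matrixP => -[[|[|[|//]]] ?] -[[|[|[|//]]] ?]; rewrite !mxE /=; ring.
(* Coordinates along [e] and across it: the x^2 and y^2 terms drop out of [crs] and have opposite
   signs in [dot], as the lemma on ternary forms requires. *)
pose dot (w : 'rV[R]_2) := w 0 0 * e 0 0 + w 0 1 * e 0 1.
pose crs (w : 'rV[R]_2) := w 0 0 * e 0 1 - w 0 1 * e 0 0.
have ee_ge0 : 0 <= dot e by rewrite addr_ge0 // -expr2 sqr_ge0.
have [||x [y [z [xyz_neq0 fxyz gxyz]]]] := @ternary_forms_common_zero R
   ((1 - r) * dot e) (- (1 + r) * dot e) (dot (phi Q33)) (dot (phi Q12))
   (dot (phi Q13)) (dot (phi Q23))
   (crs (phi Q33)) (crs (phi Q12)) (crs (phi Q13)) (crs (phi Q23)).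
- by rewrite mulr_ge0 // subr_ge0.
- by rewrite mulr_le0_ge0 // oppr_le0; lra.
pose N := x ^+ 2 + y ^+ 2 + z ^+ 2.
have N_neq0 : N != 0.
  move: xyz_neq0; apply: contraLR; rewrite negbK !negb_or !negbK.
  by rewrite !paddr_eq0 ?addr_ge0 ?sqr_ge0 // !sqrf_eq0 -andbA.
eexists; first exact: (@half_turn_SO R x y z N).
apply/eqP; rewrite -subr_eq0 -linearB /=.
set M := (X in phi X).
(* The difference from the target, cleared of denominators, is quadratic in (x, y, z). *)
have ME : N *: M = ((1 - r) * x ^+ 2 - (1 + r) * y ^+ 2) *: Q11 + z ^+ 2 *: Q33
   + (x * y) *: Q12 + (x * z) *: Q13 + (y * z) *: Q23.
  move: N_neq0; rewrite /M /N => N_neq0.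
  by apply/matrixP => -[[|[|[|//]]] ?] -[[|[|[|//]]] ?]; rewrite !mxE /=; field.
suff : N *: phi M == 0 by rewrite scaler_eq0 (negPf N_neq0).
rewrite -linearZ ME.
set w := phi _.
have wE i : w 0 i = ((1 - r) * x ^+ 2 - (1 + r) * y ^+ 2) * e 0 i + z ^+ 2 * phi Q33 0 i
   + (x * y) * phi Q12 0 i + (x * z) * phi Q13 0 i + (y * z) * phi Q23 0 i.
  by rewrite /w !linearD !linearZ /= !mxE.
have dw : dot w = 0 by rewrite -[RHS]fxyz /dot !wE; ring.
have cw : crs w = 0 by rewrite -[RHS]gxyz /crs !wE; ring.
have ee_neq0 : dot e != 0.
  apply: contra e_neq0; rewrite /dot -!expr2 paddr_eq0 ?sqr_ge0 // !sqrf_eq0.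
  move=> /andP[/eqP e00 /eqP e01]; apply/eqP/rowP => -[[|[|//]] ?]; rewrite mxE.
    by rewrite -e00; congr (e _ _); apply: val_inj.
  by rewrite -e01; congr (e _ _); apply: val_inj.
have w0 : w 0 0 = 0.
  apply: (mulIf ee_neq0); rewrite mul0r.
  transitivity (dot w * e 0 0 + crs w * e 0 1); first by rewrite /dot /crs; ring.
  by rewrite dw cw !mul0r addr0.
have w1 : w 0 1 = 0.
  apply: (mulIf ee_neq0); rewrite mul0r.
  transitivity (dot w * e 0 1 - crs w * e 0 0); first by rewrite /dot /crs; ring.
  by rewrite dw cw !mul0r subr0.
apply/eqP/rowP => -[[|[|//]] ?]; rewrite mxE.
  by rewrite -w0; congr (w _ _); apply: val_inj.
by rewrite -w1; congr (w _ _); apply: val_inj.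
Qed.

(** * Conjugation, and one disc block in higher dimension *)

Lemma attained_conj (R : realType) (n : nat) (Q Z : 'M[R]_n) :
  Q^T *m Q = 1%:M -> attained Z -> attained (Q *m Z *m Q^T).
Proof.
move=> oQ attZ; apply: attained_mul => //; first by rewrite trmxK; apply: mulmx1C.
by rewrite mulrC -det_mulmx oQ det1.
Qed.

Lemma attained_swap (R : realType) (k : nat) (A B : 'M[R]_k) :
  attained (block_mx A 0 0 B) -> attained (block_mx B 0 0 A).
Proof.
pose W : 'M[R]_(k + k) := block_mx 0 1%:M 1%:M 0.
have -> : block_mx B 0 0 A = W *m block_mx A 0 0 B *m W^T.
  rewrite tr_block_mx !mulmx_block !trmx0 !trmx1.
  by rewrite !(mul0mx, mulmx0, mul1mx, mulmx1, addr0, add0r).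
apply: attained_conj; rewrite tr_block_mx mulmx_block !trmx0 !trmx1.
by rewrite !(mul0mx, mulmx0, mul1mx, mulmx1, addr0, add0r) -scalar_mx_block.
Qed.

Lemma attained_block1 (R : realType) (k m : nat) (Z : 'M[R]_k) :
  attained Z -> attained (block_mx Z 0 0 (1%:M : 'M_m)).
Proof.
have blockE (X : 'M_k) : block_mx X 0 0 (1%:M : 'M_m) =
    block_mx 0 0 0 1%:M + col_mx 1%:M 0 *m X *m row_mx 1%:M 0.
  by rewrite mul_col_mx mul_col_row !mul0mx !mulmx0 mul1mx mulmx1 add_block_mx !addr0 !add0r.
move=> attZ; rewrite blockE; apply: attained_affine => // X SX; rewrite -blockE.
apply/SO_attained/SO_block => //.
by split; rewrite ?trmx1 ?mul1mx ?det1.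
Qed.

Lemma sim2M (R : comPzRingType) (a b c d : R) :
  sim2 a b *m sim2 c d = sim2 (a * c - b * d) (a * d + b * c).
Proof.
rewrite /sim2 mulmx_block -!scalar_mxM -!raddfD /=.
by congr (block_mx _%:M _%:M _%:M _%:M); ring.
Qed.

Lemma sim2D (R : pzRingType) (a b c d : R) :
  sim2 a b + sim2 c d = sim2 (a + c) (b + d).
Proof. by rewrite /sim2 add_block_mx -!raddfD /= opprD. Qed.

Lemma sim2Z (R : pzRingType) (t a b : R) : t *: sim2 a b = sim2 (t * a) (t * b).
Proof. by rewrite /sim2 scale_block_mx !scale_scalar_mx mulrN. Qed.

Lemma sim2_1 (R : pzRingType) : sim2 1 0 = 1%:M :> 'M[R]_(1 + 1).
Proof. by rewrite /sim2 oppr0 raddf0 -scalar_mx_block. Qed.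

Lemma sim2_SO (R : realType) (a b : R) :
  a ^+ 2 + b ^+ 2 = 1 -> @SO R (1 + 1) (sim2 a b).
Proof.
move=> ab1; have sim2T : (sim2 a b)^T = sim2 a (- b).
  by rewrite /sim2 tr_block_mx !tr_scalar_mx opprK.
split.
  by rewrite sim2T sim2M -sim2_1 -ab1; congr sim2; ring.
rewrite (@det_mx2 R) !mxE.
do ?(case: splitP => //= -[[|//] ?] //= _; rewrite ?mxE //=).
by rewrite -ab1; ring.
Qed.

(** Polar form: a + ib is a rotation times its modulus [r], and the rotation can be factored out.
    One of the [m.+1] trailing ones serves as third direction. *)
Lemma disc_attained (R : realType) (m : nat) (a b : R) :
  a ^+ 2 + b ^+ 2 <= 1 ->
  attained (block_mx (sim2 a b) 0 0 1%:M : 'M_(1 + 1 + m.+1)).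
Proof.
move=> ab_le1.
suff att3 : attained (block_mx (sim2 a b) 0 0 1%:M : 'M_(1 + 1 + 1)).
  have -> : block_mx (sim2 a b) 0 0 (1%:M : 'M_m.+1) =
      castmx (esym (addnA (1 + 1) 1 m), esym (addnA (1 + 1) 1 m))
        (block_mx (block_mx (sim2 a b) 0 0 1%:M) 0 0 1%:M).
    rewrite -[m.+1]/(1 + m)%N scalar_mx_block.
    have := @block_mxA R (1 + 1) 1 m (1 + 1) 1 m (sim2 a b) 0 0 0 1%:M 0 0 0 1%:M.
    by rewrite /= !row_mx0 !col_mx0.
  exact/attained_cast/attained_block1.
pose r := Num.sqrt (a ^+ 2 + b ^+ 2).
have ab_ge0 : 0 <= a ^+ 2 + b ^+ 2 by rewrite addr_ge0 ?sqr_ge0.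
have rr : r ^+ 2 = a ^+ 2 + b ^+ 2 by rewrite sqr_sqrtr.
have r_ge0 : 0 <= r by rewrite sqrtr_ge0.
have attr : attained (block_mx (sim2 r 0) 0 0 1%:M : 'M_(1 + 1 + 1)).
  rewrite sim2_mx3; apply: disc_attained3; apply/andP; split; last by nra.
  by apply: le_trans r_ge0; lra.
have [r0|r_neq0] := eqVneq r 0.
  have /andP[/eqP a0 /eqP b0] : (a == 0) && (b == 0).
    by rewrite -(sqrf_eq0 a) -(sqrf_eq0 b) -paddr_eq0 ?sqr_ge0 // -rr r0 expr0n.
  by rewrite a0 b0 -{1}r0.
have -> : block_mx (sim2 a b) 0 0 1%:M =
    block_mx (sim2 (a / r) (b / r)) 0 0 1%:M *m block_mx (sim2 r 0) 0 0 1%:M *m 1%:M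
    :> 'M_(1 + 1 + 1).
  rewrite mulmx1 mulmx_block !(mul0mx, mulmx0, addr0, add0r) mulmx1 sim2M.
  by congr (block_mx (sim2 _ _) _ _ _); field.
have [oU dU] : @SO R (1 + 1 + 1) (block_mx (sim2 (a / r) (b / r)) 0 0 1%:M).
  apply: SO_block; last by split; rewrite ?trmx1 ?mul1mx ?det1.
  by apply: sim2_SO; rewrite !expr_div_n -mulrDl -rr divff // expf_neq0.
by apply: attained_mul; rewrite ?trmx1 ?mul1mx ?dU ?det1 ?mul1r.
Qed.

(** * Two disc blocks in dimension 4 *)

Lemma scaled_to_unit_circle (R : rcfType) (a b p q : R) :
  a ^+ 2 + b ^+ 2 <= 1 -> (p != 0) || (q != 0) ->
  exists s, [/\ 0 <= s, (a + s * p) ^+ 2 + (b + s * q) ^+ 2 = 1 &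
    forall t, 0 <= t <= s -> (a + t * p) ^+ 2 + (b + t * q) ^+ 2 <= 1].
Proof.
move=> ab_le1 pq_neq0; pose n := p ^+ 2 + q ^+ 2; pose h := a * p + b * q.
pose c := 1 - a ^+ 2 - b ^+ 2.
have c_ge0 : 0 <= c by rewrite /c; lra.
have n_gt0 : 0 < n.
  rewrite lt0r addr_ge0 ?sqr_ge0 // andbT paddr_eq0 ?sqr_ge0 // !sqrf_eq0.
  by rewrite negb_and.
pose w := Num.sqrt (h ^+ 2 + n * c).
have nc_ge0 : 0 <= n * c by rewrite mulr_ge0 // ltW.
have ww : w ^+ 2 = h ^+ 2 + n * c by rewrite sqr_sqrtr // addr_ge0 ?sqr_ge0.
have w_ge0 : 0 <= w by rewrite sqrtr_ge0.
have wh : h <= w.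
  have [h0|/ltW h0] := lerP h 0; first exact: le_trans w_ge0.
  by rewrite -ler_sqr ?nnegrE // ww lerDl.
(* The larger root of n s^2 + 2 h s - c, where the ray leaves the disc. *)
pose s := (w - h) / n.
have s_ge0 : 0 <= s by rewrite divr_ge0 ?subr_ge0 // ltW.
have normE t : (a + t * p) ^+ 2 + (b + t * q) ^+ 2 - 1 = n * t ^+ 2 + 2 * h * t - c.
  by rewrite /n /h /c; ring.
have s_root : n * s ^+ 2 + 2 * h * s - c = 0.
  have -> : c = (w ^+ 2 - h ^+ 2) / n by rewrite ww; field; rewrite gt_eqF.
  by rewrite /s; field; rewrite gt_eqF.
exists s; split=> // [|t /andP[t_ge0 ts]].
  by apply/eqP; rewrite -subr_eq0 normE s_root.
rewrite -subr_le0 normE.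
have [s0|s_neq0] := eqVneq s 0.
  have -> : t = 0 by apply/eqP; rewrite eq_le t_ge0 -s0 ts.
  by rewrite expr0n /= !mulr0 !add0r oppr_le0.
have s_gt0 : 0 < s by rewrite lt0r s_neq0.
rewrite -(pmulr_rle0 _ s_gt0).
(* Convexity of the quadratic between 0, where it is - c, and its root s. *)
have -> : s * (n * t ^+ 2 + 2 * h * t - c) =
   t * (n * s ^+ 2 + 2 * h * s - c) - (s - t) * c - n * (s * t * (s - t)) by ring.
have st_ge0 : 0 <= s - t by rewrite subr_ge0.
rewrite s_root mulr0 sub0r -opprD oppr_le0.
apply: addr_ge0; first exact: mulr_ge0.
apply: mulr_ge0; first exact: ltW.
by apply: mulr_ge0 st_ge0; apply: mulr_ge0 s_ge0 t_ge0.
Qed.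

(** The smaller of the two exit times works; a block with zero velocity stays put and the other one
    decides. *)
Lemma pair_to_unit_circle (R : rcfType) (a b c d p q r u : R) :
  a ^+ 2 + b ^+ 2 <= 1 -> c ^+ 2 + d ^+ 2 <= 1 ->
  [|| p != 0, q != 0, r != 0 | u != 0] ->
  exists s, let N1 := (a + s * p) ^+ 2 + (b + s * q) ^+ 2 in
            let N2 := (c + s * r) ^+ 2 + (d + s * u) ^+ 2 in
    [/\ N1 <= 1, N2 <= 1 & N1 = 1 \/ N2 = 1].
Proof.
move=> ab cd; rewrite orbA.
have [pq|/norP[/negPn/eqP -> /negPn/eqP ->]] := boolP ((p != 0) || (q != 0)); last first.
  move=> /(scaled_to_unit_circle cd)[s [_ s1 _]]; exists s.
  by rewrite !mulr0 !addr0 s1; split=> //; right.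
have [s [s_ge0 s1 sle]] := scaled_to_unit_circle ab pq.
have [ru _|/norP[/negPn/eqP -> /negPn/eqP -> _]] := boolP ((r != 0) || (u != 0)); last first.
  by exists s; rewrite !mulr0 !addr0 s1; split=> //; left.
have [t [t_ge0 t1 tle]] := scaled_to_unit_circle cd ru.
have [st|ts] := lerP s t.
  by exists s; rewrite s1; split=> //; [apply: tle; rewrite s_ge0|left].
by exists t; rewrite t1; split=> //; [apply: sle; rewrite t_ge0 ltW|right].
Qed.

Lemma disc_pair_attained (R : realType) (a b c d : R) :
  a ^+ 2 + b ^+ 2 <= 1 -> c ^+ 2 + d ^+ 2 <= 1 ->
  attained (block_mx (sim2 a b) 0 0 (sim2 c d)).
Proof.
move=> ab cd.
(* A rotation block factors out, leaving one disc block and ones. *)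
have unit_right (x y z t : R) : x ^+ 2 + y ^+ 2 <= 1 -> z ^+ 2 + t ^+ 2 = 1 ->
    attained (block_mx (sim2 x y) 0 0 (sim2 z t)).
  move=> xy zt.
  have [oV dV] : @SO R (1 + 1 + (1 + 1)) (block_mx 1%:M 0 0 (sim2 z t)).
    by apply: SO_block; [split; rewrite ?trmx1 ?mul1mx ?det1|apply: sim2_SO].
  have -> : block_mx (sim2 x y) 0 0 (sim2 z t) =
      1%:M *m block_mx (sim2 x y) 0 0 1%:M *m block_mx 1%:M 0 0 (sim2 z t).
    by rewrite mul1mx mulmx_block !(mul0mx, mulmx0, addr0, add0r) mulmx1 mul1mx.
  apply: attained_mul; rewrite ?trmx1 ?mul1mx ?dV ?det1 ?mul1r //.
  exact: disc_attained.
move=> phi.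
pose D (x : 'rV[R]_4) : 'M[R]_(1 + 1 + (1 + 1)) :=
  block_mx (sim2 (x 0 0) (x 0 1)) 0 0 (sim2 (x 0 2) (x 0 3)).
have DZ t x : D (t *: x) = t *: D x.
  by rewrite /D scale_block_mx !scaler0 !sim2Z !mxE.
have DD : {morph D : x y / x + y}.
  by move=> x y; rewrite /D add_block_mx !addr0 !sim2D !mxE.
have D0 : D 0 = 0 by rewrite -(scale0r 0) DZ scale0r.
pose M : 'M[R]_(4, 2) := \matrix_i phi (D (delta_mx 0 i)).
have [v v_neq0 phiv] : exists2 v : 'rV_4, v != 0 & phi (D v) = 0.
  (* Four parameters are mapped to two coordinates, so the rank is below 4. *)
  have : kermx M != 0.
    by rewrite -mxrank_eq0 mxrank_ker -lt0n subn_gt0 (leq_ltn_trans (rank_leq_col M)).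
  case/rowV0Pn => v /sub_kermxP vM v_neq0; exists v => //.
  rewrite -vM mulmx_sum_row.
  rewrite {1}(row_sum_delta v) (big_morph D DD D0) linear_sum.
  by apply: eq_bigr => i _; rewrite DZ linearZ rowK.
have v_neq0' : [|| v 0 0 != 0, v 0 1 != 0, v 0 2 != 0 | v 0 3 != 0].
  move: v_neq0; apply: contraLR; rewrite !negb_or !negbK.
  case/and4P => /eqP v0 /eqP v1 /eqP v2 /eqP v3; apply/eqP/rowP.
  move=> -[[|[|[|[|//]]]] ?]; rewrite mxE; [rewrite -v0|rewrite -v1|rewrite -v2|rewrite -v3];
    by congr (v _ _); apply: val_inj.
have [s /= [N1 N2 N12]] := pair_to_unit_circle ab cd v_neq0'.
suff attZ' : attained (block_mx (sim2 a b) 0 0 (sim2 c d) + s *: D v).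
  by have [X SX eqX] := attZ' phi; exists X; rewrite // eqX linearD linearZ /= phiv scaler0 addr0.
rewrite /D scale_block_mx !scaler0 !sim2Z add_block_mx !addr0 !sim2D.
by case: N12 => N12; [apply: attained_swap|]; apply: unit_right.
Qed.

(** * Orthonormal bases and invariant subspaces *)

Lemma sqnorm_ge0 (R : realDomainType) (n : nat) (x : 'cV[R]_n) : 0 <= (x^T *m x) 0 0.
Proof. by rewrite mxE sumr_ge0 // => i _; rewrite !mxE -expr2 sqr_ge0. Qed.

Lemma sqnorm_eq0 (R : realDomainType) (n : nat) (x : 'cV[R]_n) :
  ((x^T *m x) 0 0 == 0) = (x == 0).
Proof.
apply/eqP/eqP => [|->]; last by rewrite mulmx0 mxE.
rewrite mxE => /psumr_eq0P h; apply/colP => i; rewrite mxE.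
have /h/(_ i isT)/eqP : forall j, true -> 0 <= x^T 0 j * x j 0.
  by move=> j _; rewrite !mxE -expr2 sqr_ge0.
by rewrite !mxE -expr2 sqrf_eq0 => /eqP.
Qed.

Lemma unit_scaling (R : rcfType) (n : nat) (x : 'cV[R]_n) :
  x != 0 -> exists c : R, (c *: x)^T *m (c *: x) = 1%:M.
Proof.
move=> x_neq0; pose N := (x^T *m x) 0 0.
have N_gt0 : 0 < N by rewrite lt0r sqnorm_eq0 x_neq0 sqnorm_ge0.
exists (Num.sqrt N)^-1.
rewrite [(_ *: _)^T]linearZ /= -scalemxAl -scalemxAr scalerA
  [x^T *m x]mx11_scalar -/N scale_scalar_mx.
by rewrite -invfM -expr2 sqr_sqrtr ?ltW // mulVf // gt_eqF.
Qed.

(** Induction appends to [E] a unit vector orthogonal to its columns. Keeping [N] as a variable with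
    an equation lets k + (m + 1) be regrouped without casts. *)
Lemma orthonormal_completion (R : rcfType) (m k N : nat) (E : 'M[R]_(N, k)) :
  N = (k + m)%N -> E^T *m E = 1%:M ->
  exists F : 'M[R]_(N, m), E^T *m F = 0 /\ F^T *m F = 1%:M.
Proof.
elim: m k E => [|m IHm] k E NE oE.
  by exists 0; rewrite mulmx0; split=> //; apply/matrixP => -[].
have [x x_neq0 Ex] : exists2 x : 'cV_N, x != 0 & E^T *m x = 0.
  have : kermx E != 0.
    rewrite -mxrank_eq0 mxrank_ker -lt0n subn_gt0 (leq_ltn_trans (rank_leq_col E)) //.
    by rewrite NE addnS ltnS leq_addr.
  case/rowV0Pn => u /sub_kermxP uE u_neq0; exists u^T.
    by rewrite -trmx0 (inj_eq trmx_inj).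
  by rewrite -trmx_mul uE trmx0.
have [c ow] := unit_scaling x_neq0; set w := c *: x in ow.
have Ew : E^T *m w = 0 by rewrite -scalemxAr Ex scaler0.
have [||F [EwF oF]] := IHm (k + 1)%N (row_mx E w).
- by rewrite NE addnS addn1.
- by rewrite tr_row_mx mul_col_row oE ow Ew -[w^T *m E]trmxK
    trmx_mul trmxK Ew trmx0 -scalar_mx_block.
move: EwF; rewrite tr_row_mx mul_col_mx -[0]col_mx0 => /eq_col_mx[EF wF].
rewrite -[m.+1]/(1 + m)%N; exists (row_mx w F); split.
  by rewrite mul_mx_row Ew EF row_mx0.
by rewrite tr_row_mx mul_col_row ow oF wF -[F^T *m w]trmxK trmx_mul trmxK wF trmx0 -scalar_mx_block.
Qed.

Lemma orthogonal_block_decomposition (R : rcfType) (k m : nat) (Y : 'M[R]_(k + m))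
    (E : 'M[R]_(k + m, k)) (B : 'M[R]_k) :
  Y^T *m Y = 1%:M -> E^T *m E = 1%:M -> Y *m E = E *m B ->
  exists (F : 'M[R]_(k + m, m)) (Y' : 'M[R]_m),
    [/\ (row_mx E F)^T *m row_mx E F = 1%:M,
        Y = row_mx E F *m block_mx B 0 0 Y' *m (row_mx E F)^T,
        Y'^T *m Y' = 1%:M & \det Y = \det B * \det Y'].
Proof.
move=> oY oE YE; have [F [EF oF]] := orthonormal_completion (erefl (k + m)%N) oE.
have FE : F^T *m E = 0 by rewrite -[LHS]trmxK trmx_mul trmxK EF trmx0.
have oB : B^T *m B = 1%:M.
  have -> : B = E^T *m (Y *m E) by rewrite YE mulmxA oE mul1mx.
  rewrite !trmx_mul trmxK -!mulmxA (mulmxA E) [X in _ *m (_ *m X)](_ : _ = Y *m E).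
    by rewrite (mulmxA Y^T) oY mul1mx.
  by rewrite -mulmxA YE (mulmxA E^T) oE mul1mx.
(* The span of [E] is also invariant under [Y^T], so its orthogonal complement is invariant under
   [Y]. *)
have YTE : Y^T *m E = E *m B^T.
  by rewrite -[LHS]mulmx1 -(mulmx1C oB) mulmxA -[Y^T *m E *m B]mulmxA -YE mulmxA oY mul1mx.
pose Q := row_mx E F; pose Y' := F^T *m Y *m F.
have oQ : Q^T *m Q = 1%:M.
  by rewrite tr_row_mx mul_col_row oE oF EF FE -scalar_mx_block.
have QQ : Q *m Q^T = 1%:M := mulmx1C oQ.
have QYQ : Q^T *m Y *m Q = block_mx B 0 0 Y'.
  rewrite tr_row_mx mul_col_mx mul_col_row; congr block_mx.
  - by rewrite -mulmxA YE mulmxA oE mul1mx.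
  - by rewrite -[E^T *m Y]trmxK trmx_mul trmxK YTE trmx_mul trmxK -mulmxA EF mulmx0.
  - by rewrite -mulmxA YE mulmxA FE mul0mx.
have YQ : Y = Q *m block_mx B 0 0 Y' *m Q^T.
  by rewrite -QYQ !mulmxA QQ mul1mx -mulmxA QQ mulmx1.
exists F, Y'; split=> //.
  have : (Q^T *m Y *m Q)^T *m (Q^T *m Y *m Q) = 1%:M.
    by rewrite !trmx_mul trmxK !mulmxA -[_ *m Q *m Q^T]mulmxA QQ mulmx1
      -[_ *m Y^T *m Y]mulmxA oY mulmx1.
  rewrite QYQ tr_block_mx mulmx_block !trmx0 !(mul0mx, mulmx0, addr0, add0r) scalar_mx_block.
  by case/eq_block_mx.
rewrite YQ !det_mulmx det_ublock mulrAC -[RHS]mul1r; congr (_ * _).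
by rewrite -det_mulmx QQ det1.
Qed.

(** * Invariant lines and planes of a rotation *)

Lemma orthogonal_eigenvector_N1 (R : rcfType) (m : nat) (Y : 'M[R]_m) :
  Y^T *m Y = 1%:M -> \det Y = -1 -> exists2 x : 'cV[R]_m, x != 0 & Y *m x = - x.
Proof.
move=> oY dY.
have : \det (1%:M + Y)^T == 0.
  (* [Y^T (1 + Y) = (1 + Y)^T], so the determinant of [1 + Y] is its own opposite. *)
  have : \det (Y^T *m (1%:M + Y)) = \det (1%:M + Y)^T.
    by rewrite mulmxDr mulmx1 oY linearD /= trmx1 addrC.
  rewrite det_mulmx !det_tr dY => h; apply/eqP; lra.
case/det0P => u u_neq0 uY; exists u^T.
  by rewrite -trmx0 (inj_eq trmx_inj).
apply/eqP; rewrite -addr_eq0 addrC -[X in X + _]mul1mx -mulmxDl.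
by rewrite -[1%:M + Y]trmxK -trmx_mul uY trmx0.
Qed.

(* A unit eigenvector [w] of the symmetric matrix [Y + Y^T] satisfies
   [Y (Y w) = 2 c (Y w) - w], so [w] and [Y w] span an invariant subspace. *)
Lemma SO_eigenvector_or_plane (R : realType) (m : nat) (Y : 'M[R]_(1 + m)) :
  @SO R (1 + m) Y ->
  (exists2 w : 'cV[R]_(1 + m), w^T *m w = 1%:M & Y *m w = w) \/
  (exists (E : 'M[R]_(1 + m, 1 + 1)) (c s : R),
     [/\ E^T *m E = 1%:M, c ^+ 2 + s ^+ 2 = 1 & Y *m E = E *m sim2 c s]).
Proof.
move=> [oY dY].
have symS : (Y + Y^T)^T = Y + Y^T by rewrite linearD /= trmxK addrC.
have [a [v [v_neq0 vS]]] := symmetric_eigenvector symS.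
have [w ow Sw] : exists2 w : 'cV[R]_(1 + m), w^T *m w = 1%:M & (Y + Y^T) *m w = a *: w.
  have [k ow] := unit_scaling v_neq0; exists (k *: v) => //.
  by rewrite -scalemxAr vS !scalerA mulrC.
(* [c] is the cosine of the angle from [w] to [Y *m w], as [Y] and [Y^T] contribute equally to
   [a]. *)
pose c := a / 2; pose u := Y *m w.
have wS : u + Y^T *m w = (2 * c) *: w.
  have -> : 2 * c = a by rewrite /c; field.
  by rewrite -mulmxDl Sw.
have Yu : Y *m u = (2 * c) *: u - w.
  rewrite -{1}(addrK (Y^T *m w) u) wS mulmxBr -scalemxAr; congr (_ - _).
  by rewrite mulmxA (mulmx1C oY) mul1mx.
have ou : u^T *m u = 1%:M by rewrite trmx_mul mulmxA -[_ *m Y^T *m Y]mulmxA oY mulmx1.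
have wu : w^T *m u = c%:M.
  have sym : w^T *m (Y^T *m w) = w^T *m u.
    by rewrite [RHS]mx11_scalar -tr_scalar_mx -mx11_scalar !trmx_mul trmxK mulmxA.
  have : w^T *m u + w^T *m u = (2 * c)%:M.
    by rewrite -{2}sym -mulmxDr wS -scalemxAr ow scalemx1.
  move/matrixP/(_ 0 0); rewrite !mxE /= !mulr1n => h.
  by rewrite [LHS]mx11_scalar; congr _%:M; rewrite mxE; lra.
have uw : u^T *m w = c%:M by rewrite -[LHS]trmxK trmx_mul trmxK wu tr_scalar_mx.
pose x := u - c *: w.
have wx : w^T *m x = 0.
  by rewrite mulmxBr wu -scalemxAr ow scalemx1 subrr.
have xx : x^T *m x = (1 - c ^+ 2)%:M.
  rewrite {1}/x [(_ - _)^T]linearB /= mulmxBl [(_ *: _)^T]linearZ /= -scalemxAl wx scaler0 subr0.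
  by rewrite mulmxBr ou -scalemxAr uw scale_scalar_mx -expr2 -raddfB.
have x0 : c ^+ 2 = 1 -> u = c *: w.
  move=> cc; apply/eqP; rewrite -subr_eq0 -sqnorm_eq0 -/x xx cc subrr.
  by rewrite mxE mul0rn.
have [c1|c_neq1] := eqVneq c 1.
  by left; exists w; rewrite // -/u x0 c1 ?expr1n ?scale1r.
(* If [c = -1], then [w] is reversed and the complement has determinant -1, so it contains a second
   reversed vector; the two span a plane of half-turn. *)
right; have [cN1|c_neqN1] := eqVneq c (-1).
  have YwN : Y *m w = w *m (-1)%:M.
    by rewrite mul_mx_scalar -cN1; apply: x0; rewrite cN1 sqrrN expr1n.
  have [F [Y' [oQ YE oY' dY']]] := orthogonal_block_decomposition oY ow YwN.
  have [|f f_neq0 Yf] := orthogonal_eigenvector_N1 oY'.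
    by move: dY'; rewrite dY det_scalar1 => h; lra.
  have [l of'] := unit_scaling f_neq0; set f' := l *: f in of'.
  move: (oQ); rewrite tr_row_mx mul_col_row scalar_mx_block => /eq_block_mx[_ wF Fw oF].
  exists (row_mx w (F *m f')), (-1), 0; split.
  - rewrite tr_row_mx mul_col_row ow trmx_mul -[_ *m w]mulmxA Fw mulmxA wF mul0mx mulmx0.
    by rewrite mulmxA -[_ *m F]mulmxA oF mulmx1 of' -scalar_mx_block.
  - by rewrite sqrrN expr1n expr0n addr0.
  have YF : Y *m F = F *m Y'.
    have : Y *m row_mx w F = row_mx w F *m block_mx (-1)%:M 0 0 Y'.
      by rewrite {1}YE -[LHS]mulmxA oQ mulmx1.
    rewrite mul_mx_row mul_row_block !mulmx0 add0r addr0.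
    by case/eq_row_mx.
  rewrite /sim2 mul_mx_row mul_row_block YwN mulmxA YF -mulmxA -scalemxAr Yf.
  rewrite oppr0 raddf0 !mulmx0 addr0 add0r !mul_mx_scalar scaleN1r; congr row_mx.
  by rewrite scaleN1r scalerN mulmxN.
have cc_ge0 : 0 <= 1 - c ^+ 2.
  by have := sqnorm_ge0 x; rewrite xx mxE.
have cc_neq0 : 1 - c ^+ 2 != 0.
  have -> : 1 - c ^+ 2 = (1 - c) * (c + 1) by ring.
  by rewrite mulf_eq0 negb_or subr_eq0 addr_eq0 c_neqN1 andbT eq_sym.
(* Gram-Schmidt: [s] is the norm of [x], the part of [u] orthogonal to [w]. *)
pose s := Num.sqrt (1 - c ^+ 2).
have ss : s ^+ 2 = 1 - c ^+ 2 by rewrite sqr_sqrtr.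
have s_neq0 : s != 0 by rewrite -sqrf_eq0 ss.
pose f := s^-1 *: x.
have xf : x = s *: f by rewrite scalerA divff // scale1r.
exists (row_mx w f), c, s; split; last 1 first.
- rewrite /sim2 mul_mx_row mul_row_block !mul_mx_scalar; congr row_mx.
    by rewrite -xf /x addrC subrK.
  rewrite /f -scalemxAr mulmxBr Yu -scalemxAr -/u.
  have -> : 2 * c *: u - w - c *: u = c *: x - s ^+ 2 *: w.
    rewrite ss /x; apply/colP => i; rewrite !mxE; ring.
  by apply/colP => i; rewrite !mxE; field.
- rewrite tr_row_mx mul_col_row ow /f [(s^-1 *: x)^T]linearZ /= -!scalemxAr -!scalemxAl wx.
  rewrite -[x^T *m w]trmxK trmx_mul trmxK wx trmx0 !scaler0 xx -ss scalerA scale_scalar_mx.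
  have -> : s^-1 * s^-1 * s ^+ 2 = 1 by field.
  by rewrite -scalar_mx_block.
by rewrite ss addrC subrK.
Qed.

Lemma SO1 (R : realType) (Y : 'M[R]_1) : @SO R 1 Y -> Y = 1%:M.
Proof. by case=> _ dY; rewrite [Y]mx11_scalar -det_mx11 dY. Qed.

Lemma SO2_sim2 (R : realType) (Y : 'M[R]_(1 + 1)) : @SO R (1 + 1) Y ->
  exists c s : R, c ^+ 2 + s ^+ 2 = 1 /\ Y = sim2 c s.
Proof.
move=> [/matrixP oY]; rewrite (@det_mx2 R) => dY.
have lift1 : lift ord0 ord0 = 1 :> 'I_2 by apply: val_inj.
have := oY 0 0; have := oY 1 1.
rewrite !mxE !big_ord_recl !big_ord0 !mxE /= !addr0 !lift1 !mulr1n -!expr2 => col1 col0.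
set a := Y 0 0 in dY col0 *; set b := Y 0 1 in dY col1 *.
set c := Y 1 0 in dY col0 *; set d := Y 1 1 in dY col1 *.
(* The sum of the two squares is the sum of the squared column norms minus twice the determinant, 2
   - 2 = 0. *)
have /andP[/eqP ad /eqP bc] : (a - d == 0) && (b + c == 0).
  rewrite -(sqrf_eq0 (a - d)) -(sqrf_eq0 (b + c)) -paddr_eq0 ?sqr_ge0 //.
  by apply/eqP; move: dY col0 col1; rewrite -/a -/b -/c -/d => dY col0 col1; lra.
exists a, c; split; first by [].
apply/matrixP => -[[|[|//]] ?] -[[|[|//]] ?]; rewrite !mxE.
all: do ?(case: splitP => //= -[[|//] ?] //= _; rewrite ?mxE //=).
- by rewrite mulr1n; congr (Y _ _); apply: val_inj.
- have <- : b = - c by apply/eqP; rewrite -addr_eq0 bc.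
  by rewrite mulr1n; congr (Y _ _); apply: val_inj.
- by rewrite mulr1n; congr (Y _ _); apply: val_inj.
- have -> : a = d by apply/eqP; rewrite -subr_eq0 ad.
  by rewrite mulr1n; congr (Y _ _); apply: val_inj.
Qed.

(** * Segments from the identity to a rotation *)

Definition segment1 (R : pzRingType) (n : nat) (t : R) (Y : 'M[R]_n) :=
  (1 - t)%:M + t *: Y.

Lemma segment1_conj (R : comPzRingType) (n : nat) (t : R) (Q Y : 'M[R]_n) :
  Q *m Q^T = 1%:M -> segment1 t (Q *m Y *m Q^T) = Q *m segment1 t Y *m Q^T.
Proof.
move=> QQ; rewrite /segment1 mulmxDr mulmxDl mul_mx_scalar -!scalemxAl QQ.
by rewrite -scalemxAr -scalemxAl scalemx1.
Qed.

Lemma segment1_block (R : pzRingType) (k m : nat) (t : R) (A : 'M[R]_k) (B : 'M[R]_m) :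
  segment1 t (block_mx A 0 0 B) = block_mx (segment1 t A) 0 0 (segment1 t B).
Proof. by rewrite /segment1 scalar_mx_block scale_block_mx !scaler0 add_block_mx !addr0. Qed.

Lemma segment1_1 (R : pzRingType) (n : nat) (t : R) : segment1 t 1%:M = 1%:M :> 'M_n.
Proof. by rewrite /segment1 scalemx1 -raddfD subrK. Qed.

Lemma segment1_sim2 (R : pzRingType) (t c s : R) :
  segment1 t (sim2 c s) = sim2 (1 - t + t * c) (t * s).
Proof. by rewrite /segment1 -scalemx1 -sim2_1 !sim2Z sim2D mulr1 mulr0 add0r. Qed.

(** Strong induction on the size, splitting off an invariant plane or a fixed line. *)
Lemma segment1_attained (R : realType) (n : nat) (t : R) (Y : 'M[R]_n) :
  (3 <= n)%N -> 0 <= t <= 1 -> @SO R n Y -> attained (segment1 t Y).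
Proof.
move=> + t01; have [N] := ubnP n; elim: N n Y => // N IH n Y.
rewrite ltnS => nN n3 SY; have [oY dY] := SY.
have disc (c s : R) : c ^+ 2 + s ^+ 2 = 1 -> (1 - t + t * c) ^+ 2 + (t * s) ^+ 2 <= 1.
  move=> cs; have c1 : c <= 1 by nra.
  have -> : (1 - t + t * c) ^+ 2 + (t * s) ^+ 2 =
     1 - 2 * (t * (1 - t) * (1 - c)) + t ^+ 2 * (c ^+ 2 + s ^+ 2 - 1) by ring.
  rewrite cs subrr mulr0 addr0 gerBl.
  by case/andP: t01 => t0 t1; rewrite !mulr_ge0 ?subr_ge0.
(* The block beside the plane is 1 in size 1, a second disc block in size 2, and from size 3 on is
   traded for a rotation by induction and factored out. *)
have blocks (m : nat) (X : 'M[R]_m.+1) (c s : R) :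
    (1 + 1 + m.+1 <= N)%N -> @SO R m.+1 X -> c ^+ 2 + s ^+ 2 = 1 ->
    attained (block_mx (segment1 t (sim2 c s)) 0 0 (segment1 t X)).
  rewrite segment1_sim2; case: m X => [|[|m]] X mN SX cs.
  - by rewrite (SO1 SX) segment1_1; exact/disc_attained/disc.
  - have [c' [s' [cs' ->]]] := SO2_sim2 SX.
    by rewrite segment1_sim2; apply: disc_pair_attained; apply: disc.
  apply: attained_block => [|Z SZ].
    by apply: IH => //; apply: leq_trans mN.
  have [oV dV] : @SO R (1 + 1 + m.+3) (block_mx 1%:M 0 0 Z).
    by apply: SO_block => //; split; rewrite ?trmx1 ?mul1mx ?det1.
  have -> : block_mx (sim2 (1 - t + t * c) (t * s)) 0 0 Z =
      1%:M *m block_mx (sim2 (1 - t + t * c) (t * s)) 0 0 1%:M *m block_mx 1%:M 0 0 Z.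
    by rewrite mul1mx mulmx_block !(mul0mx, mulmx0, addr0, add0r) mulmx1 mul1mx.
  apply: attained_mul; rewrite ?trmx1 ?mul1mx ?dV ?det1 ?mul1r //.
  exact/disc_attained/disc.
have plane (m : nat) (X : 'M[R]_(1 + 1 + m.+1)) (E : 'M_(1 + 1 + m.+1, 1 + 1)) (c s : R) :
    (1 + 1 + m.+1 <= N)%N -> @SO R (1 + 1 + m.+1) X ->
    E^T *m E = 1%:M -> c ^+ 2 + s ^+ 2 = 1 -> X *m E = E *m sim2 c s ->
    attained (segment1 t X).
  move=> mN [oX dX] oE cs XE.
  have [F [X' [oQ XQ oX' dX']]] := orthogonal_block_decomposition oX oE XE.
  rewrite XQ segment1_conj; last exact: mulmx1C.
  apply: attained_conj => //; rewrite segment1_block; apply: blocks => //.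
  split=> //; move: dX'; rewrite dX.
  by have [_ ->] := sim2_SO cs; rewrite mul1r.
case: n => [//|[//|[//|m]]] in Y nN n3 SY oY dY *.
have [[w ow Yw]|[E [c [s [oE cs YE]]]]] := @SO_eigenvector_or_plane R m.+2 Y SY; last first.
  exact: (plane m Y E c s).
have Yw1 : Y *m w = w *m 1%:M by rewrite mulmx1.
have [F [Y' [oQ YQ oY' dY']]] := @orthogonal_block_decomposition R 1 m.+2 Y w 1%:M oY ow Yw1.
have SY' : @SO R m.+2 Y' by split=> //; rewrite -dY dY' det1 mul1r.
rewrite YQ (@segment1_conj _ (1 + m.+2)); last exact: mulmx1C.
apply: (@attained_conj _ (1 + m.+2)) => //.
rewrite segment1_block segment1_1.
(* Beside the fixed line, induction needs a block of size at least 3. For n = 3 the last two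
   coordinates form an invariant plane instead. *)
case: m => [|m] in Y nN n3 SY oY dY Y' SY' {w ow Yw Yw1 F oQ YQ oY' dY'} *; last first.
  apply: attained_block => [|Z SZ].
    by apply: IH => //; apply: leq_trans nN.
  apply/SO_attained/SO_block => //.
  by split; rewrite ?trmx1 ?mul1mx ?det1.
have [c [s [cs Y'E]]] := SO2_sim2 SY'.
have E1 : (1%:M : 'M[R]_1) = segment1 t 1%:M by rewrite segment1_1.
rewrite E1 -(@segment1_block _ 1 2).
pose E : 'M[R]_(1 + 2, 2) := col_mx 0 1%:M.
have oE : E^T *m E = 1%:M.
  by rewrite tr_col_mx mul_row_col trmx1 mulmx0 mulmx1 add0r.
have YE : block_mx 1%:M 0 0 Y' *m E = E *m sim2 c s.
  by rewrite mul_block_col mul_col_mx !(mul0mx, mulmx0, mulmx1, mul1mx, add0r) Y'E.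
apply: (plane 0 _ E c s) => //.
by apply: (@SO_block _ 1 2) => //; split; rewrite ?trmx1 ?mul1mx ?det1.
Qed.

(** * Convexity of the image *)

Local Open Scope classical_set_scope.

Theorem corollary1 (R : realType) (n : nat) (hn : (3 <= n)%N)
    (pi : {linear 'M[R]_n -> 'rV[R]_2}) :
  convex_set (pi @` @SO R n).
Proof.
move=> x y l; rewrite !inE => -[X SX <-] [Y SY <-].
have [oX dX] := SX; have [oY dY] := SY.
have SZ : @SO R n (X^T *m Y).
  split; last by rewrite det_mulmx det_tr dX dY mulr1.
  by rewrite trmx_mul trmxK mulmxA -[_ *m X *m _]mulmxA (mulmx1C oX) mulmx1.
(* The convex combination gives [X] the weight [l], so the parameter on the segment from [X] to [Y]
   is [1 - l]. *)
have l01 : 0 <= 1 - l%:num <= 1 by rewrite subr_ge0 gerBl ge0 le1.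
have [] := @attained_mul R n X 1%:M _ oX _ _ (segment1_attained hn l01 SZ) pi.
- by rewrite trmx1 mulmx1.
- by rewrite dX det1 mulr1.
move=> Z SOZ eqZ; exists Z => //; rewrite eqZ mulmx1 /segment1 subKr.
rewrite mulmxDr mul_mx_scalar -scalemxAr mulmxA (mulmx1C oX) mul1mx.
by rewrite linearD !linearZ.
Qed.
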